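(* Let $p$ be an odd prime and let $\lambda\in\mathbb{C}_p$ with $|\lambda|_p<p^{-\frac{1}{p-1}}$. For every positive integer $n$, $$\int_{\mathbb{Z}_p}(1-x)_{n,\lambda}\,d\mu_{-1}(x)=\int_{\mathbb{Z}_p}(x+2)_{n,\lambda}\,d\mu_{-1}(x)=2(1)_{n,\lambda}+\int_{\mathbb{Z}_p}(x)_{n,\lambda}\,d\mu_{-1}(x).$$
   Context: $\mathbb{C}_p$ is the completion of the algebraic closure of $\mathbb{Q}_p$, with normalized absolute value $|p|_p=1/p$. For $x\in\mathbb{C}_p$ define $(x)_{0,\lambda}=1$ and $(x)_{n,\lambda}=x(x-\lambda)(x-2\lambda)\cdots(x-(n-1)\lambda)$ for $n\ge 1$. For a continuous function $f$ on $\mathbb{Z}_p$, the fermionic $p$-adic integral on $\mathbb{Z}_p$ is $$\int_{\mathbb{Z}_p}f(x)\,d\mu_{-1}(x)=\lim_{N\to\infty}\sum_{x=0}^{p^N-1}f(x)(-1)^x.$$ *)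

(* Defs.v *)
From HB Require Import structures.
From mathcomp Require Import all_boot all_order all_algebra.
From mathcomp Require Import all_classical all_reals all_analysis.

Set Implicit Arguments.
Unset Strict Implicit.
Unset Printing Implicit Defensive.

Import Order.TTheory GRing.Theory Num.Theory.

Local Open Scope classical_set_scope.
Local Open Scope ring_scope.

(* The ultrametric inequality is not required: it holds in every extension of
   (rat, padic_abs p), the only case used below. *)
Record absValuedField (R : realType) := AbsValuedField {
  absField : fieldType;
  absval_def : absField -> R;
  absval_def_ge0 : forall x, 0 <= absval_def x;
  absval_def_eq0 : forall x, absval_def x = 0 <-> x = 0;
  absval_defM : forall x y,
    absval_def (x * y) = absval_def x * absval_def y;
  absval_defD : forall x y,
    absval_def (x + y) <= absval_def x + absval_def y
}.

(* absField K under a new name, so that instances can equip it with the metric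
   |x - y|. Num.NormedZmodule is unusable, as it imposes |x *+ n| = |x| *+ n;
   and HB admits no structure joining GRing.Field with Metric, because
   PseudoMetricNormedZmod would have to inherit from a weaker join. *)
Definition abs_sort (R : realType) (K : absValuedField R) : Type := absField K.
Coercion abs_sort : absValuedField >-> Sortclass.

HB.instance Definition _ (R : realType) (K : absValuedField R) :=
  GRing.Field.copy (abs_sort K) (absField K).
HB.instance Definition _ (R : realType) (K : absValuedField R) :=
  isPointed.Build (abs_sort K) 0.

Definition absval (R : realType) (K : absValuedField R) (x : K) : R :=
  absval_def x.

Section AbsValuedFieldMetric.
Context {R : realType} (K : absValuedField R).
Implicit Types x y z : K.

Lemma absvalM x y : absval (x * y) = absval x * absval y.
Proof. exact: absval_defM. Qed.

Lemma absvalD x y : absval (x + y) <= absval x + absval y.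
Proof. exact: absval_defD. Qed.

Lemma absval_ge0 x : 0 <= absval x.
Proof. exact: absval_def_ge0. Qed.

Lemma absval0_eq0 x : absval x = 0 -> x = 0.
Proof. by move/absval_def_eq0. Qed.

Lemma absval0 : absval (0 : K) = 0.
Proof. exact/absval_def_eq0. Qed.

Lemma absvalN x : absval (- x) = absval x.
Proof.
by apply/eqP; rewrite -(@eqrXn2 _ 2) ?absval_ge0// !expr2 -!absvalM mulrNN.
Qed.

Let dist x y := absval (x - y).

Let distxx x : dist x x = 0.
Proof. by rewrite /dist subrr absval0. Qed.

Let dist_eq0 x y : dist x y = 0 -> x = y.
Proof. by move/absval0_eq0/eqP; rewrite subr_eq0 => /eqP. Qed.

Let dist_sym x y : dist x y = dist y x.
Proof. by rewrite /dist -absvalN opprB. Qed.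

Let dist_triangle y x z : dist x z <= dist x y + dist y z.
Proof. by rewrite /dist (le_trans _ (absvalD _ _))// addrA subrK. Qed.

HB.instance Definition _ :=
  isMetric.Build R (abs_sort K) distxx dist_eq0 dist_sym dist_triangle.

End AbsValuedFieldMetric.

Definition padic_abs (R : realType) (p : nat) (q : rat) : R :=
  if q == 0 then 0
  else p%:R ^+ logn p `|denq q|%N / p%:R ^+ logn p `|numq q|%N.

Definition complete (T : uniformType) : Prop :=
  forall F : set_system T, ProperFilter F -> cauchy F -> exists l : T, F --> l.

(* The absolute value v is a parameter, rather than part of the structure of K,
   so that K can be rat with its p-adic absolute value. *)
Definition is_completion (R : realType) (K : fieldType) (v : K -> R)
    (L : absValuedField R) (f : {rmorphism K -> L}) : Prop :=
  [/\ forall x, absval (f x) = v x, dense (range f) & complete L].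

Definition is_algebraic_closure (K L : fieldType) (f : {rmorphism K -> L}) :
    Prop :=
  GRing.closed_field_axiom L /\ forall x : L, algebraicOver f x.

(* rat -> Q_p -> algebraic closure of Q_p -> C_p; each arrow, hence C_p with
   its absolute value, is determined up to isometric isomorphism. *)
Record padicComplex (R : realType) (p : nat) := PadicComplex {
  Qp : absValuedField R;
  Qpbar : absValuedField R;
  Cp :> absValuedField R;
  rat_to_Qp : {rmorphism rat -> Qp};
  Qp_to_Qpbar : {rmorphism Qp -> Qpbar};
  Qpbar_to_Cp : {rmorphism Qpbar -> Cp};
  Qp_completion : is_completion (padic_abs R p) rat_to_Qp;
  Qpbar_isometry : forall x, absval (Qp_to_Qpbar x) = absval x;
  Qpbar_algebraic_closure : is_algebraic_closure Qp_to_Qpbar;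
  Cp_completion : is_completion (@absval R Qpbar) Qpbar_to_Cp
}.

Definition padicInt (R : realType) (p : nat) (C : padicComplex R p) : Type :=
  {x : Qp C | absval x <= 1}.

Definition padicInt_to_Cp (R : realType) (p : nat) (C : padicComplex R p)
    (x : padicInt C) : C :=
  Qpbar_to_Cp C (Qp_to_Qpbar C (val x)).

Lemma padic_abs_nat_le1 (R : realType) (p n : nat) :
  padic_abs R p n%:R <= 1.
Proof.
rewrite /padic_abs; case: eqP => // _.
have -> : n%:R = (n%:Z)%:Q :> rat by rewrite pmulrn.
rewrite denq_int numq_int /= logn1 expr0 div1r.
case: p => [|p]; first by rewrite lognE /= expr0 invr1.
by rewrite invf_le1 ?exprn_gt0 ?ltr0n // exprn_ege1 // ler1n.
Qed.

Lemma padicInt_nat_subproof (R : realType) (p : nat) (C : padicComplex R p)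
  (n : nat) : absval (n%:R : Qp C) <= 1.
Proof.
have [vE _ _] := Qp_completion C.
by rewrite -(rmorph_nat (rat_to_Qp C)) vE padic_abs_nat_le1.
Qed.

Definition padicInt_nat (R : realType) (p : nat) (C : padicComplex R p)
  (n : nat) :
  padicInt C := exist _ n%:R (padicInt_nat_subproof C n).

Definition fermionic_sum (R : realType) (p : nat) (C : padicComplex R p)
    (f : padicInt C -> C) (N : nat) : C :=
  \sum_(0 <= x < p ^ N) f (padicInt_nat C x) * (-1) ^+ x.

Definition fermionic_integrable (R : realType) (p : nat)
    (C : padicComplex R p) (f : padicInt C -> C) : Prop :=
  cvg (fermionic_sum f @ \oo).

(* The default value of lim unless f is fermionic_integrable. *)
Definition fermionic_integral (R : realType) (p : nat)
    (C : padicComplex R p) (f : padicInt C -> C) : C :=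
  lim (fermionic_sum f @ \oo).

Definition degenerate_ffact (K : fieldType) (lambda x : K) (n : nat) : K :=
  \prod_(0 <= i < n) (x - i%:R * lambda).

(* Main.v *)
(* Every polynomial P over C_p is Q(X + 1) + Q(X) for some polynomial Q, so the
   alternating sum of P over 0 <= x < m, m odd, telescopes to Q(0) + Q(m); as
   p ^ N tends to 0, the fermionic integral of P is 2 Q(0). For P = (X)_n,
   both Q(2 - X) and Q(X + 2) are antidifferences, of P(1 - X) and P(X + 2)
   respectively, and take the value Q(2) at 0; finally
   Q(2) = P(1) - P(0) + Q(0) with P(0) = 0. *)
Require Import Defs.
From mathcomp Require Import all_boot all_order all_algebra.
From mathcomp Require Import all_classical all_reals all_analysis.
From mathcomp Require Import ring.

Import Order.TTheory GRing.Theory Num.Theory.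
Import numFieldNormedType.Exports.

Local Open Scope classical_set_scope.
Local Open Scope ring_scope.

(** Substituting ['X + 1] keeps both the size and the leading coefficient, so the top terms
    cancel. *)
Lemma size_comp_poly_shift1_sub (K : fieldType) (P : {poly K}) :
  P != 0 -> (size (P - (P \Po ('X + 1)))%R < size P)%N.
Proof.
move=> P0; have szX1 : size ('X + 1 : {poly K}) = 2%N.
  by rewrite -[1]opprK -polyCN size_XsubC.
have szP : size (P \Po ('X + 1)) = size P by rewrite size_comp_poly2.
have lcP : lead_coef (P \Po ('X + 1)) = lead_coef P.
  rewrite lead_coef_comp ?szX1// -[1]opprK -polyCN lead_coefXsubC.
  by rewrite expr1n mulr1.
rewrite -[ltnRHS]prednK ?size_poly_gt0// ltnS; apply/leq_sizeP => j.
rewrite leq_eqVlt => /predU1P[<-|ltj].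
  by rewrite coefB -lead_coefE -[X in _`_X.-1]szP -lead_coefE lcP subrr.
have sj : (size P <= j)%N by case: (size P) ltj.
by rewrite coefB !nth_default ?szP// subrr.
Qed.

(** By induction on the size: [P / 2] is an antidifference of [P] up to the error
    [(P - P(X + 1)) / 2], which has smaller size and so has an antidifference itself. *)
Lemma poly_alternating_antidifference (K : fieldType) (P : {poly K}) :
  2 != 0 :> K -> exists Q : {poly K}, Q \Po ('X + 1) + Q = P.
Proof.
move=> two0; have [m] := ubnP (size P); elim: m P => // m IH P.
rewrite ltnS => szP; have [->|P0] := eqVneq P 0.
  by exists 0; rewrite comp_poly0 addr0.
have [Q QE] : exists Q, Q \Po ('X + 1) + Q = 2^-1 *: (P - (P \Po ('X + 1))).
  apply: IH; rewrite size_scale ?invr_eq0//.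
  exact: leq_trans (size_comp_poly_shift1_sub _ _ P0) szP.
exists (2^-1 *: P + Q); rewrite comp_polyD comp_polyZ addrACA QE.
rewrite scalerBr addrC subrKA.
by rewrite -scalerDl -mulr2n -(mulr_natr 2^-1) mulVf// scale1r.
Qed.

Lemma alternating_sum_telescope (K : pzRingType) (f g : nat -> K) (m : nat) :
  (forall x, f x = g x.+1 + g x) ->
  \sum_(0 <= x < m) f x * (-1) ^+ x = g 0%N - g m * (-1) ^+ m.
Proof.
move=> fE; elim: m => [|m IH]; first by rewrite big_geq// mulr1 subrr.
rewrite big_nat_recr//= IH fE exprSr mulrN1 mulrN opprK mulrDl.
by rewrite [X in _ + X]addrC addrA subrK.
Qed.

Section FermionicPolynomial.
Context (R : realType) (p : nat) (p_prime : prime p) (C : padicComplex R p).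

Lemma absval_Cp_nat (n : nat) : absval (n%:R : C) = padic_abs R p n%:R.
Proof.
have [vQ _ _] := Qp_completion C; have [vC _ _] := Cp_completion C.
rewrite -(rmorph_nat (Qpbar_to_Cp C)) vC -(rmorph_nat (Qp_to_Qpbar C)).
by rewrite Qpbar_isometry -(rmorph_nat (rat_to_Qp C)) vQ.
Qed.

(** Characteristic zero passes from [rat] to [C] along field morphisms, which are injective. The
    case [n = 2] allows halving polynomials over [C]. *)
Lemma Cp_nat_neq0 (n : nat) : (0 < n)%N -> n%:R != 0 :> C.
Proof.
move=> n0; rewrite -(rmorph_nat (Qpbar_to_Cp C)) -(rmorph_nat (Qp_to_Qpbar C)).
by rewrite -(rmorph_nat (rat_to_Qp C)) !fmorph_eq0 pnatr_eq0 -lt0n.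
Qed.

Lemma padicInt_to_Cp_nat (n : nat) :
  padicInt_to_Cp (padicInt_nat C n) = n%:R.
Proof. by rewrite /padicInt_to_Cp /= !rmorph_nat. Qed.

Lemma padic_abs_expn (N : nat) : padic_abs R p (p ^ N)%:R = p%:R^-1 ^+ N.
Proof.
have p0 := prime_gt0 p_prime.
rewrite /padic_abs pnatr_eq0 expn_eq0 eqn0Ngt p0/=.
have -> : (p ^ N)%:R = ((p ^ N)%:Z)%:Q :> rat by rewrite pmulrn.
by rewrite denq_int numq_int /= logn1 expr0 div1r pfactorK// exprVn.
Qed.

(** On the unit ball the sum of the absolute values of the coefficients is a bound. *)
Lemma absval_horner_bounded (L : absValuedField R) (Q : {poly L}) :
  exists M : R, forall x : L, absval x <= 1 -> absval Q.[x] <= M.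
Proof.
elim/poly_ind: Q => [|Q c [M QM]].
  by exists 0 => x _; rewrite horner0 absval0.
exists (M + absval c) => x x1; rewrite hornerMXaddC.
apply: le_trans (absvalD _ _) _; rewrite lerD2r absvalM.
apply: le_trans (QM _ x1).
by rewrite ler_piMr// absval_ge0.
Qed.

(** Writing the polynomial as [Q * 'X + c], the difference is [- Q.[x] * x], and the cofactor [Q] is
    bounded on the unit ball; only this decomposition is taken from [poly_ind]. *)
Lemma absval_horner_lipschitz0 (L : absValuedField R) (Q : {poly L}) :
  exists M : R,
    forall x : L, absval x <= 1 -> absval (Q.[0] - Q.[x]) <= absval x * M.
Proof.
elim/poly_ind: Q => [|Q c _].
  by exists 0 => x _; rewrite !horner0 subrr absval0 mulr0.
have [M QM] := absval_horner_bounded _ Q; exists M => x x1.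
rewrite !hornerMXaddC mulr0 add0r opprD addrCA subrr addr0 absvalN absvalM.
by rewrite mulrC ler_wpM2l ?absval_ge0// QM.
Qed.

(** The distance to the limit is at most [M] times the absolute value of [p ^ N], which is
    [p^-1 ^+ N]. *)
Lemma cvg_horner_expn (Q : {poly C}) :
  (fun N => Q.[(p ^ N)%:R]) @ \oo --> Q.[0].
Proof.
have [M QM] := absval_horner_lipschitz0 C Q.
have px1 N : absval ((p ^ N)%:R : C) <= 1.
  by rewrite absval_Cp_nat padic_abs_nat_le1.
have cvgM : (fun N => p%:R^-1 ^+ N * M : R) @ \oo --> (0 : R).
  rewrite -[X in _ --> X](mul0r M); apply: cvgMr_tmp.
  apply: cvg_expr; rewrite ger0_norm ?invr_ge0//.
  by rewrite invf_lt1 ?ltr0n ?ltr1n ?prime_gt0 ?prime_gt1.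
apply/cvg_ballP => e e0; near=> N.
rewrite ballEmdist /=; apply: (le_lt_trans (QM _ (px1 N))).
rewrite absval_Cp_nat padic_abs_expn; near: N.
by apply: (cvgr_lt _ cvgM).
Unshelve. all: by end_near. Qed.

Lemma cvg_fermionic_sum (p_odd : odd p) (f : padicInt C -> C) (Q : {poly C}) :
  (forall x, f x = Q.[padicInt_to_Cp x + 1] + Q.[padicInt_to_Cp x]) ->
  fermionic_sum f @ \oo --> Q.[0] + Q.[0].
Proof.
move=> fE; have -> : fermionic_sum f = fun N => Q.[0] + Q.[(p ^ N)%:R].
  apply/funext => N; rewrite /fermionic_sum.
  rewrite (alternating_sum_telescope _ _ (fun x => Q.[x%:R])) => [|x].
    (* As [p ^ N] is odd, the boundary term changes sign and is added. *)
    by rewrite -signr_odd oddX p_odd orbT expr1 mulrN1 opprK.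
  by rewrite fE padicInt_to_Cp_nat natr1.
have /cvg_ballP QN := cvg_horner_expn Q.
(* The metric is translation invariant, so the constant [Q.[0]] cancels. *)
apply/cvg_ballP => e /QN; apply: filterS => N; rewrite !ballEmdist /=.
by rewrite /mdist/= opprD addrACA subrr add0r.
Qed.

Lemma fermionic_integralE (p_odd : odd p) (f : padicInt C -> C) (Q : {poly C}) :
  (forall x, f x = Q.[padicInt_to_Cp x + 1] + Q.[padicInt_to_Cp x]) ->
  fermionic_integrable f /\ fermionic_integral f = Q.[0] + Q.[0].
Proof.
move=> /(cvg_fermionic_sum p_odd) fQ; split; first exact: cvgP fQ.
exact: (@cvg_lim C (@metric_hausdorff R C)) fQ.
Qed.

End FermionicPolynomial.

Theorem theorem2p2 (R : realType) (p : nat) (p_prime : prime p)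
    (p_odd : odd p) (C : padicComplex R p) (lambda : C)
    (lambda_small : absval lambda < p%:R `^ (- (p%:R - 1)^-1))
    (n : nat) (n_gt0 : (0 < n)%N) :
  let f1 := fun x : padicInt C => degenerate_ffact lambda (1 - padicInt_to_Cp x) n in
  let f2 := fun x : padicInt C => degenerate_ffact lambda (padicInt_to_Cp x + 2) n in
  let f3 := fun x : padicInt C => degenerate_ffact lambda (padicInt_to_Cp x) n in
  [/\ fermionic_integrable f1, fermionic_integrable f2,
      fermionic_integrable f3,
      fermionic_integral f1 = fermionic_integral f2
    & fermionic_integral f2 =
        2 * degenerate_ffact lambda 1 n + fermionic_integral f3].
Proof.
move=> f1 f2 f3.
pose P : {poly C} := \prod_(0 <= i < n) ('X - (i%:R * lambda)%:P).
have PE x : P.[x] = degenerate_ffact lambda x n.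
  by rewrite horner_prod; apply: eq_bigr => i _; rewrite hornerXsubC.
have P0 : P.[0] = 0.
  (* Since [n > 0], the product contains the factor with [i = 0], which vanishes at 0. *)
  by rewrite PE /degenerate_ffact big_ltn// mul0r subrr mul0r.
have [Q QE] := poly_alternating_antidifference _ P (Cp_nat_neq0 _ _ C 2 isT).
have QP x : Q.[x + 1] + Q.[x] = P.[x].
  by rewrite -QE hornerD horner_comp !hornerE.
have [i1 ->] : fermionic_integrable f1 /\ fermionic_integral f1 = Q.[2] + Q.[2].
  have := fermionic_integralE _ _ p_prime C p_odd f1 (Q \Po (2%:P - 'X)).
  rewrite horner_comp !hornerE subr0; apply => x.
  (* The reflection exchanges the two terms: [x + 1] is sent to [1 - x], and [x] to [(1 - x) + 1];
     hence [addrC]. *)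
  rewrite !horner_comp !hornerE /f1 -PE -QP addrC.
  by congr (_.[_] + _.[_]); ring.
have [i2 ->] : fermionic_integrable f2 /\ fermionic_integral f2 = Q.[2] + Q.[2].
  have := fermionic_integralE _ _ p_prime C p_odd f2 (Q \Po ('X + 2%:P)).
  rewrite horner_comp hornerD hornerX hornerC add0r; apply => x.
  rewrite !horner_comp !hornerD !hornerX !hornerC /f2 -PE -QP.
  by congr (_.[_] + _.[_]); ring.
have [i3 ->] : fermionic_integrable f3 /\ fermionic_integral f3 = Q.[0] + Q.[0].
  by apply: fermionic_integralE => // x; rewrite QP PE.
(* Relation [QP] at 1 expresses [P.[1]] by [Q.[2]] and [Q.[1]]; at 0 it gives [Q.[1] + Q.[0] = 0],
   which eliminates [Q.[0]]. *)
split=> //; rewrite -PE -QP; have := QP 0; rewrite P0 add0r => Q10.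
have -> : Q.[0] = - Q.[1] by apply/eqP; rewrite -addr_eq0 addrC Q10.
by rewrite (_ : 1 + 1 = 2)//; ring.
Qed.
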